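(* Let $\mu=(\mu_1,\mu_2)$ be any choice of system parameters with $(\kappa_1^0,\kappa_2^0)|_{\mu=0}=0$, and let $g_{11},g_{21}\in\mathbb{R}^2$, $g_{30},g_{40}\in\mathbb{R}$ be the coefficients of the reduced vector field on the center manifold. Then $$g_{11}=\frac{6\sqrt2}{5\hat\tau\hat\theta}\left(\nabla_\mu\kappa_1^0\right)\Big|_{\mu=0},\qquad g_{21}=-\frac{3}{5\sqrt2\,\hat\tau\hat\theta}\left(3\nabla_\mu\kappa_2^0-\frac72(\hat\tau+\hat\theta)\nabla_\mu\kappa_1^0\right)\Big|_{\mu=0},$$ as well as $$g_{30}=-\frac{3\sqrt2}{20}\left(\frac{\kappa_3^0}{\hat\tau\hat\theta}\right)\Big|_{\mu=0}=\frac15\,\frac{D^2\hat\tau-\hat\theta}{D^2(\hat\tau-\hat\theta)}\Big|_{\mu=0},\qquad g_{40}=-\frac3{40}\,\frac{3(D^2\hat\tau^2-\hat\theta^2)+7\hat\tau\hat\theta(1-D^2)}{D^2(\hat\tau-\hat\theta)}\Big|_{\mu=0}.$$ In particular, $g_{30}=0$ is equivalent to $\kappa_3^0|_{\mu=0}=0$, and in this case $g_{40}=-\frac34\hat\tau<0$. Conversely, if $g_{40}=0$ then $7\hat\tau>3\hat\theta$ and $g_{30}=\frac{2\hat\tau}{7\hat\tau-3\hat\theta}>0$. Moreover, if $g_{30}<0$ then $g_{40}<0$.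
   Context: Parameters: $\alpha,\beta\in\mathbb{R}$, $\hat\tau,\hat\theta>0$, $D>1$. Set $$\kappa_1^0=\alpha\hat\tau+\beta\frac{\hat\theta}{D}-\frac{2\sqrt2}{3},\qquad \kappa_2^0=\alpha\hat\tau^2+\frac{\beta}{D}\hat\theta^2,\qquad \kappa_3^0=\alpha\hat\tau^3+\beta\frac{\hat\theta^3}{D^3}.$$ $\nabla_\mu$ is the gradient with respect to $\mu$, where the system parameters are functions of $\mu$. The coefficients arise as follows. Fronts of the reaction-diffusion system $\partial_tU=\varepsilon^2\partial_x^2U+U-U^3-\varepsilon(\alpha V+\beta W)$, $\frac{\hat\tau}{\varepsilon^2}\partial_tV=\partial_x^2V+U-V$, $\frac{\hat\theta}{\varepsilon^2}\partial_tW=D^2\partial_x^2W+U-W$ ($0<\varepsilon\ll1$, $x\in\mathbb{R}$) near the stationary front and near parameters with $\kappa_1^0=\kappa_2^0=0$ (to leading order, triple zero eigenvalue of the linearization) are governed on a three-dimensional center manifold by $\dot a=\varepsilon^2c$, $\dot c=\varepsilon^2\tilde c$, $\dot{\tilde c}=\varepsilon^2G(c,\tilde c,\mu)=\varepsilon^2(G_1(c,\mu)+\tilde c\,G_2(c,\tilde c,\mu))+o(\varepsilon^2)$, with $a$ the front position, $G_1(c,\mu)=(g_{10}+g_{11}\cdot\mu)c+g_{30}c^3+\text{h.o.t.}$ and $G_2(c,0,\mu)=g_{20}+g_{21}\cdot\mu+g_{40}c^2+\text{h.o.t.}$ These coefficients are given by $g_{10}=g_{20}=0$ and $$g_{30}=-\frac13\frac{a_{20}(0)}{a_{02}(0)},\quad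 g_{40}=-\frac1{a_{02}(0)}\left(a_{21}(0)-\frac{a_{20}(0)a_{03}(0)}{a_{02}(0)}\right),$$ $$g_{11}=-\frac{\nabla_\mu a_{00}(0)}{a_{02}(0)},\quad g_{21}=-\frac1{a_{02}(0)}\left[\nabla_\mu a_{01}(0)-\frac{\nabla_\mu a_{00}(0)\,a_{03}(0)}{a_{02}(0)}\right],$$ where, as functions of $\mu$ through the system parameters, $$a_{00}=\tfrac14\kappa_1^0,\quad a_{20}=-\tfrac3{32}\kappa_3^0,\quad a_{01}=-\tfrac3{16}\kappa_2^0,\quad a_{21}=\tfrac{15}{128}\Big(\alpha\hat\tau^4+\tfrac{\beta}{D^3}\hat\theta^4\Big),$$ $$a_{02}=\tfrac5{32}\Big(\alpha\hat\tau^3+\tfrac\beta D\hat\theta^3\Big),\quad a_{03}=-\tfrac{35}{256}\Big(\alpha\hat\tau^4+\tfrac\beta D\hat\theta^4\Big).$$ All quantities $\hat\tau,\hat\theta,D$ in the conclusions are evaluated at $\mu=0$. *)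

(* Defs.v *)
From Stdlib Require Export Reals.
From Coquelicot Require Export Coquelicot.
Open Scope R_scope.

(** Parameters of the reaction-diffusion system
      U_t = eps^2 U_xx + U - U^3 - eps (alpha V + beta W),
      (tau / eps^2) V_t = V_xx + U - V,
      (theta / eps^2) W_t = D^2 W_xx + U - W,
    with [diffusion] standing for D. *)
Record params : Type := Params {
  alpha : R;
  beta : R;
  tau : R;
  theta : R;
  diffusion : R
}.

Definition admissible (q : params) : Prop :=
  0 < tau q /\ 0 < theta q /\ 1 < diffusion q.

Definition kappa1 (q : params) : R :=
  alpha q * tau q + beta q * (theta q / diffusion q) - 2 * sqrt 2 / 3.

Definition kappa2 (q : params) : R :=
  alpha q * tau q ^ 2 + beta q / diffusion q * theta q ^ 2.

Definition kappa3 (q : params) : R :=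
  alpha q * tau q ^ 3 + beta q * (theta q ^ 3 / diffusion q ^ 3).

(** [a20] and [a21] carry D^3 in the beta-term, [a02] and [a03] only D. *)
Definition a00 (q : params) : R := 1 / 4 * kappa1 q.
Definition a20 (q : params) : R := - (3 / 32) * kappa3 q.
Definition a01 (q : params) : R := - (3 / 16) * kappa2 q.
Definition a21 (q : params) : R :=
  15 / 128 * (alpha q * tau q ^ 4 + beta q / diffusion q ^ 3 * theta q ^ 4).
Definition a02 (q : params) : R :=
  5 / 32 * (alpha q * tau q ^ 3 + beta q / diffusion q * theta q ^ 3).
Definition a03 (q : params) : R :=
  - (35 / 256) * (alpha q * tau q ^ 4 + beta q / diffusion q * theta q ^ 4).

Definition origin : R * R := (0, 0).

(** [Derive] is total: this is the gradient only where [f] is differentiable. *)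
Definition grad (f : R * R -> R) (mu : R * R) : R * R :=
  (Derive (fun s => f (s, snd mu)) (fst mu),
   Derive (fun s => f (fst mu, s)) (snd mu)).

Definition dot (u v : R * R) : R := fst u * fst v + snd u * snd v.

(** Differentiable dependence of the system parameters on [mu] at [mu0]. *)
Definition differentiable_params (p : R * R -> params) (mu0 : R * R) : Prop :=
  ex_filterdiff (fun mu => alpha (p mu)) (locally mu0) /\
  ex_filterdiff (fun mu => beta (p mu)) (locally mu0) /\
  ex_filterdiff (fun mu => tau (p mu)) (locally mu0) /\
  ex_filterdiff (fun mu => theta (p mu)) (locally mu0) /\
  ex_filterdiff (fun mu => diffusion (p mu)) (locally mu0).

(** [G c d mu] is the leading-order nonlinearity of the reduced system
      a' = eps^2 c,  c' = eps^2 d,  d' = eps^2 G(c, d, mu) + o(eps^2),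
    split as [G = G1(c, mu) + d G2(c, d, mu)] near the origin, where
      G1(c, mu)    = (g10 + g11 . mu) c + g30 c^3 + h.o.t.,
      G2(c, 0, mu) = g20 + g21 . mu + g40 c^2 + h.o.t.
    The higher-order terms are [o(|c| |mu| + |c|^3)] and [o(|mu| + |c|^2)].
    Continuity of [G2] at [d = 0] makes [G2(c, 0, mu)], and with it all the
    coefficients, uniquely determined by [G]. *)
Definition reduced_field_expansion (G : R -> R -> R * R -> R)
    (g10 : R) (g11 : R * R) (g30 g20 : R) (g21 : R * R) (g40 : R) : Prop :=
  exists (G1 : R -> R * R -> R) (G2 : R -> R -> R * R -> R),
    locally ((0, 0), origin) (fun z : (R * R) * (R * R) =>
      let '((c, d), mu) := z in G c d mu = G1 c mu + d * G2 c d mu) /\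
    locally (0, origin) (fun z : R * (R * R) =>
      let '(c, mu) := z in continuous (fun d => G2 c d mu) 0) /\
    is_domin (locally (0, origin))
      (fun z : R * (R * R) =>
        let '(c, mu) := z in Rabs c * norm mu + Rabs c ^ 3)
      (fun z : R * (R * R) =>
        let '(c, mu) := z in
        G1 c mu - ((g10 + dot g11 mu) * c + g30 * c ^ 3)) /\
    is_domin (locally (0, origin))
      (fun z : R * (R * R) =>
        let '(c, mu) := z in norm mu + Rabs c ^ 2)
      (fun z : R * (R * R) =>
        let '(c, mu) := z in
        G2 c 0 mu - (g20 + dot g21 mu + g40 * c ^ 2)).

(* Main.v *)
Require Import Defs.
From Stdlib Require Import Reals Lra.
From Coquelicot Require Import Coquelicot.
Open Scope R_scope.

(** The power sums [S n = alpha tau^n + (beta / D) theta^n] satisfy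
    [S (n+2) = (tau + theta) S (n+1) - tau theta S n], and the triple-zero
    condition reads [S 1 = 2 sqrt 2 / 3], [S 2 = 0].  Hence
    [S 3 = - tau theta S 1] and [S 4 = (tau + theta) S 3], which settles [a02]
    and [a03].  Solving the two conditions for [alpha] and [beta] (they force
    [tau <> theta]) makes [kappa3] and [a21] explicit in [tau], [theta], [D].
    The sign claims then concern rational functions of [tau], [theta], [D^2]. *)

Lemma sqrt2_neq0 : sqrt 2 <> 0.
Proof. apply Rgt_not_eq, sqrt_lt_R0; lra. Qed.

(** If the two time scales coincided, [kappa2] would equal [tau * (kappa1 + 2 * sqrt 2 / 3)], which
    is positive once [kappa1] vanishes. *)
Lemma triple_zero_tau_neq_theta (q : params) :
  kappa1 q = 0 -> kappa2 q = 0 -> 0 < tau q -> tau q <> theta q.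
Proof.
unfold kappa1, kappa2; intros H1 H2 Ht Heq.
rewrite <- Heq in H1, H2.
assert (Hz : tau q * (alpha q * tau q + beta q * (tau q / diffusion q)) = 0)
  by (rewrite <- H2; unfold Rdiv; ring).
apply Rmult_integral in Hz; pose proof (sqrt_lt_R0 2 ltac:(lra)); lra.
Qed.

Lemma triple_zero_alpha (q : params) :
  kappa1 q = 0 -> kappa2 q = 0 -> 0 < tau q ->
  alpha q = 2 * sqrt 2 / 3 * theta q / (tau q * (theta q - tau q)).
Proof.
intros H1 H2 Ht.
pose proof (triple_zero_tau_neq_theta q H1 H2 Ht) as Hne.
assert (H : alpha q * (tau q * (theta q - tau q)) = 2 * sqrt 2 / 3 * theta q).
(* The combination [theta * kappa1 - kappa2] eliminates [beta]. *)
{ replace (alpha q * (tau q * (theta q - tau q)))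
    with (theta q * kappa1 q - kappa2 q + 2 * sqrt 2 / 3 * theta q)
    by (unfold kappa1, kappa2, Rdiv; ring).
  rewrite H1, H2; ring. }
rewrite <- H; field; lra.
Qed.

Lemma triple_zero_beta (q : params) :
  kappa1 q = 0 -> kappa2 q = 0 -> admissible q ->
  beta q = 2 * sqrt 2 / 3 * diffusion q * tau q
           / (theta q * (tau q - theta q)).
Proof.
intros H1 H2 (Ht & Hh & HD).
pose proof (triple_zero_tau_neq_theta q H1 H2 Ht) as Hne.
assert (H : beta q / diffusion q * (theta q * (tau q - theta q))
            = 2 * sqrt 2 / 3 * tau q).
(* Likewise [tau * kappa1 - kappa2] eliminates [alpha]. *)
{ replace (beta q / diffusion q * (theta q * (tau q - theta q)))
    with (tau q * kappa1 q - kappa2 q + 2 * sqrt 2 / 3 * tau q)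
    by (unfold kappa1, kappa2, Rdiv; ring).
  rewrite H1, H2; ring. }
replace (2 * sqrt 2 / 3 * diffusion q * tau q)
  with (diffusion q * (2 * sqrt 2 / 3 * tau q)) by ring.
rewrite <- H; field; lra.
Qed.

Lemma triple_zero_a02 (q : params) :
  kappa1 q = 0 -> kappa2 q = 0 ->
  a02 q = - (5 * sqrt 2 / 48) * (tau q * theta q).
Proof.
intros H1 H2.
replace (a02 q)
  with (5 / 32 * ((tau q + theta q) * kappa2 q - tau q * theta q * kappa1 q)
        - 5 * sqrt 2 / 48 * (tau q * theta q))
  (* With the inverse of D as an opaque variable, the identity is polynomial and raises no side
     condition on D. *)
  by (unfold a02, kappa1, kappa2, Rdiv; generalize (/ diffusion q); intros; field).
rewrite H1, H2; ring.
Qed.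

(** The factor [- (7 / 8)] is the ratio of the prefactors [- (35 / 256)] of [a03] and [5 / 32] of
    [a02]. *)
Lemma triple_zero_a03 (q : params) :
  kappa2 q = 0 -> a03 q = - (7 / 8) * (tau q + theta q) * a02 q.
Proof.
intros H2.
replace (a03 q)
  with (- (7 / 8) * (tau q + theta q) * a02 q
        + 35 / 256 * (tau q * theta q) * kappa2 q)
  by (unfold a03, a02, kappa2, Rdiv; generalize (/ diffusion q); intros; field).
rewrite H2; ring.
Qed.

Lemma triple_zero_kappa3 (q : params) :
  kappa1 q = 0 -> kappa2 q = 0 -> admissible q ->
  kappa3 q = - (2 * sqrt 2 / 3) * (tau q * theta q) *
    ((diffusion q ^ 2 * tau q - theta q)
     / (diffusion q ^ 2 * (tau q - theta q))).
Proof.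
intros H1 H2 Hq; generalize Hq; intros (Ht & Hh & HD).
pose proof (triple_zero_tau_neq_theta q H1 H2 Ht) as Hne.
unfold kappa3.
rewrite (triple_zero_alpha q H1 H2 Ht), (triple_zero_beta q H1 H2 Hq).
field; repeat split; lra.
Qed.

Lemma triple_zero_a21 (q : params) :
  kappa1 q = 0 -> kappa2 q = 0 -> admissible q ->
  a21 q = - (5 * sqrt 2 / 64) * (tau q * theta q) *
    ((diffusion q ^ 2 * tau q ^ 2 - theta q ^ 2)
     / (diffusion q ^ 2 * (tau q - theta q))).
Proof.
intros H1 H2 Hq; generalize Hq; intros (Ht & Hh & HD).
pose proof (triple_zero_tau_neq_theta q H1 H2 Ht) as Hne.
unfold a21.
rewrite (triple_zero_alpha q H1 H2 Ht), (triple_zero_beta q H1 H2 Hq).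
field; repeat split; lra.
Qed.

Lemma grad_scal (k : R) (f : R * R -> R) (mu : R * R) :
  grad (fun x => k * f x) mu = scal k (grad f mu).
Proof. unfold grad; rewrite !Derive_scal; reflexivity. Qed.

Lemma Rdiv_eq_0 (x y : R) : y <> 0 -> x / y = 0 -> x = 0.
Proof. intros Hy H; replace x with (x / y * y) by (field; exact Hy); rewrite H; ring. Qed.

(** Here and in the next two lemmas [t], [h], [d] stand for tau, theta, D^2, and the two fractions
    are [g30] and [g40]. Vanishing of the first means [h = d * t], which turns the numerator of the
    second into [10 * d * t ^ 2 * (1 - d)]. *)
Lemma cubic_coefficient_zero (t h d : R) :
  d <> 0 -> t <> h ->
  1 / 5 * ((d * t - h) / (d * (t - h))) = 0 ->
  - (3 / 40) * ((3 * (d * t ^ 2 - h ^ 2) + 7 * t * h * (1 - d)) / (d * (t - h)))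
  = - (3 / 4) * t.
Proof.
intros Hd Hne H.
assert (Hh : d * t - h = 0).
{ apply (Rdiv_eq_0 _ (d * (t - h))); [apply Rmult_integral_contrapositive; lra | lra]. }
replace h with (d * t) in * by lra.
field; lra.
Qed.

(* The vanishing numerator reads [d t (7 h - 3 t) = h (7 t - 3 h)]; as [d > 1],
   both brackets are positive. *)
Lemma damping_coefficient_zero (t h d : R) :
  0 < t -> 0 < h -> 1 < d -> t <> h ->
  - (3 / 40) * ((3 * (d * t ^ 2 - h ^ 2) + 7 * t * h * (1 - d)) / (d * (t - h)))
  = 0 ->
  3 * h < 7 * t /\
  1 / 5 * ((d * t - h) / (d * (t - h))) = 2 * t / (7 * t - 3 * h).
Proof.
intros Ht Hh Hd Hne H.
assert (HN : d * t * (7 * h - 3 * t) = h * (7 * t - 3 * h)).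
{ assert (3 * (d * t ^ 2 - h ^ 2) + 7 * t * h * (1 - d) = 0); [|lra].
  apply (Rdiv_eq_0 _ (d * (t - h))); [apply Rmult_integral_contrapositive; lra | lra]. }
assert (Hpos : 3 * h < 7 * t).
(* If [7 * t <= 3 * h], then [7 * h - 3 * t] is positive, so in [HN] the left side is positive and
   the right side is not. *)
{ apply Rnot_le_lt; intros Hle.
  assert (0 < d * t * (7 * h - 3 * t)) by (repeat apply Rmult_lt_0_compat; lra).
  assert (h * (7 * t - 3 * h) <= h * 0) by (apply Rmult_le_compat_l; lra).
  lra. }
split; [exact Hpos|].
(* Cross-multiplied, the claim is a rearrangement of [HN]. *)
field_simplify_eq; [|lra].
nra.
Qed.

(* [g30 < 0] means [t < h < d t]. *)
Lemma cubic_coefficient_neg (t h d : R) :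
  0 < t -> 0 < h -> 1 < d -> t <> h ->
  1 / 5 * ((d * t - h) / (d * (t - h))) < 0 ->
  - (3 / 40) * ((3 * (d * t ^ 2 - h ^ 2) + 7 * t * h * (1 - d)) / (d * (t - h)))
  < 0.
Proof.
intros Ht Hh Hd Hne H.
assert (Hdt : t < d * t) by nra.
assert (Hlt : t < h).
{ apply Rnot_le_lt; intros Hle.
  assert (0 < (d * t - h) / (d * (t - h))); [|lra].
  apply Rdiv_lt_0_compat; [|apply Rmult_lt_0_compat]; nra. }
assert (Hhd : h < d * t).
{ apply Rnot_le_lt; intros Hle.
  assert (0 <= (h - d * t) / (d * (h - t))) as Hge
    by (apply Rdiv_le_0_compat; [|apply Rmult_lt_0_compat]; lra).
  replace ((h - d * t) / (d * (h - t)))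
    with ((d * t - h) / (d * (t - h))) in Hge by (field; lra).
  lra. }
(* Both signs are flipped to make the denominator positive. The numerator is then [(d * t - h) * (7
   * h - 3 * t) + 10 * h * (h - t)], a sum of positive terms. *)
assert (0 < (3 * (h ^ 2 - d * t ^ 2) + 7 * t * h * (d - 1)) / (d * (h - t)))
  as Hp.
{ apply Rdiv_lt_0_compat; [|apply Rmult_lt_0_compat; lra].
  assert (0 < (d * t - h) * (7 * h - 3 * t)) by (apply Rmult_lt_0_compat; lra).
  assert (0 < h * (h - t)) by (apply Rmult_lt_0_compat; lra).
  nra. }
replace ((3 * (d * t ^ 2 - h ^ 2) + 7 * t * h * (1 - d)) / (d * (t - h)))
  with ((3 * (h ^ 2 - d * t ^ 2) + 7 * t * h * (d - 1)) / (d * (h - t)))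
  by (field; lra).
lra.
Qed.

Theorem corollary1
  (p : R * R -> params)
  (Hadm : locally origin (fun mu => admissible (p mu)))
  (Hdiff : differentiable_params p origin)
  (Hk1 : kappa1 (p origin) = 0)
  (Hk2 : kappa2 (p origin) = 0)
  (G : R -> R -> R * R -> R)
  (g10 g20 g30 g40 : R) (g11 g21 : R * R)
  (HG : reduced_field_expansion G g10 g11 g30 g20 g21 g40)
  (Hg10 : g10 = 0)
  (Hg20 : g20 = 0)
  (Hg30 : g30 = - (1 / 3) * (a20 (p origin) / a02 (p origin)))
  (Hg40 : g40 = - (1 / a02 (p origin)) *
     (a21 (p origin) - a20 (p origin) * a03 (p origin) / a02 (p origin)))
  (Hg11 : g11 = scal (- (1 / a02 (p origin)))
     (grad (fun mu => a00 (p mu)) origin))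
  (Hg21 : g21 = scal (- (1 / a02 (p origin)))
     (minus (grad (fun mu => a01 (p mu)) origin)
            (scal (a03 (p origin) / a02 (p origin))
                  (grad (fun mu => a00 (p mu)) origin)))) :
  let tau0 := tau (p origin) in
  let theta0 := theta (p origin) in
  let D0 := diffusion (p origin) in
  g11 = scal (6 * sqrt 2 / (5 * tau0 * theta0))
          (grad (fun mu => kappa1 (p mu)) origin) /\
  g21 = scal (- (3 / (5 * sqrt 2 * tau0 * theta0)))
          (minus (scal 3 (grad (fun mu => kappa2 (p mu)) origin))
                 (scal (7 / 2 * (tau0 + theta0))
                       (grad (fun mu => kappa1 (p mu)) origin))) /\
  g30 = - (3 * sqrt 2 / 20) * (kappa3 (p origin) / (tau0 * theta0)) /\
  g30 = 1 / 5 * ((D0 ^ 2 * tau0 - theta0) / (D0 ^ 2 * (tau0 - theta0))) /\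
  g40 = - (3 / 40) *
    ((3 * (D0 ^ 2 * tau0 ^ 2 - theta0 ^ 2) + 7 * tau0 * theta0 * (1 - D0 ^ 2))
     / (D0 ^ 2 * (tau0 - theta0))) /\
  (g30 = 0 <-> kappa3 (p origin) = 0) /\
  (g30 = 0 -> g40 = - (3 / 4) * tau0 /\ g40 < 0) /\
  (g40 = 0 ->
     3 * theta0 < 7 * tau0 /\
     g30 = 2 * tau0 / (7 * tau0 - 3 * theta0) /\ 0 < g30) /\
  (g30 < 0 -> g40 < 0).
Proof.
intros tau0 theta0 D0.
pose proof (locally_singleton _ _ Hadm) as Hq; cbv beta in Hq.
generalize Hq; intros (Ht & Hh & HD).
pose proof (triple_zero_tau_neq_theta _ Hk1 Hk2 Ht) as Hne.
pose proof (triple_zero_a02 _ Hk1 Hk2) as E02.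
pose proof (triple_zero_a03 _ Hk2) as E03.
pose proof (triple_zero_kappa3 _ Hk1 Hk2 Hq) as Ek3.
pose proof (triple_zero_a21 _ Hk1 Hk2 Hq) as E21.
pose proof sqrt2_neq0 as Hr.
assert (Hr2 : sqrt 2 * sqrt 2 = 2) by (apply sqrt_sqrt; lra).
fold tau0 in Ht, Hne, E02, E03, Ek3, E21.
fold theta0 in Hh, Hne, E02, E03, Ek3, E21.
fold D0 in HD, Ek3, E21.
clearbody tau0 theta0 D0.
assert (H02 : a02 (p origin) <> 0).
{ rewrite E02; apply Rmult_integral_contrapositive_currified;
    [|apply Rmult_integral_contrapositive]; lra. }
(* The factor 4 stands apart because it cancels the [1 / 4] in [a00]. *)
assert (Hinv : - (1 / a02 (p origin)) = 4 * (6 * sqrt 2 / (5 * tau0 * theta0))).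
{ rewrite E02; field_simplify_eq; [|lra]. nra. }
(* The prefactor of [g21] has [sqrt 2] in the denominator; with this form [field] can conclude
   without knowing that [sqrt 2] squares to 2. *)
assert (Hsq : 6 * sqrt 2 / (5 * tau0 * theta0)
              = 12 / (5 * sqrt 2 * tau0 * theta0)).
{ field_simplify_eq; [|lra]. nra. }
assert (E303 : a03 (p origin) / a02 (p origin) = - (7 / 8) * (tau0 + theta0)).
{ rewrite E03; field; exact H02. }
assert (G30 : g30 = 1 / 5 * ((D0 ^ 2 * tau0 - theta0) / (D0 ^ 2 * (tau0 - theta0)))).
{ rewrite Hg30; unfold a20; rewrite E02, Ek3; field; repeat split; lra. }
assert (G30' : g30 = - (3 * sqrt 2 / 20) * (kappa3 (p origin) / (tau0 * theta0))).
{ rewrite Hg30; unfold a20.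
  replace (- (1 / 3) * (- (3 / 32) * kappa3 (p origin) / a02 (p origin)))
    with (- (1 / 32) * kappa3 (p origin) * (- (1 / a02 (p origin))))
    by (field; exact H02).
  rewrite Hinv; field; lra. }
assert (G40 : g40 = - (3 / 40) *
    ((3 * (D0 ^ 2 * tau0 ^ 2 - theta0 ^ 2) + 7 * tau0 * theta0 * (1 - D0 ^ 2))
     / (D0 ^ 2 * (tau0 - theta0)))).
{ rewrite Hg40; unfold a20.
  (* Reassociating isolates the quotient of [a03] by [a02], to which [E303] applies. *)
  unfold Rdiv at 2; rewrite Rmult_assoc; fold (a03 (p origin) / a02 (p origin)).
  rewrite E303, E21, Ek3, E02; field; repeat split; lra. }
assert (HD2 : 1 < D0 ^ 2) by nra.
repeat apply conj; try assumption.
- rewrite Hg11, Hinv; unfold a00.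
  rewrite grad_scal, scal_assoc; f_equal.
  unfold mult; simpl; field; lra.
- rewrite Hg21, Hinv, Hsq, E303; unfold a00, a01.
  rewrite !grad_scal.
  (* The claim is linear in the two gradients, so arbitrary pairs can replace them. *)
  destruct (grad (fun x => kappa1 (p x)) origin) as [x1 y1].
  destruct (grad (fun x => kappa2 (p x)) origin) as [x2 y2].
  cbv [scal minus plus opp]; simpl.
  cbv [prod_scal prod_plus prod_opp scal plus opp mult]; simpl.
  cbv [mult]; simpl.
  f_equal; field; lra.
- rewrite G30'; intros H.
  apply (Rdiv_eq_0 _ (tau0 * theta0)).
  + apply Rmult_integral_contrapositive; lra.
  + apply Rmult_integral in H as [H|H]; lra.
- rewrite G30'; intros H; rewrite H; field; lra.
- intros H; rewrite G30 in H.
  assert (E : g40 = - (3 / 4) * tau0)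
    by (rewrite G40; apply cubic_coefficient_zero; lra).
  lra.
- rewrite G30, G40; intros H.
  destruct (damping_coefficient_zero tau0 theta0 (D0 ^ 2)) as [Hlt E];
    try assumption.
  rewrite E; repeat split; try lra.
  apply Rdiv_lt_0_compat; lra.
- rewrite G30, G40; apply cubic_coefficient_neg; assumption.
Qed.
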